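(* Let $m\ge 2$ and $n\ge 1$ be integers, and let $f^{RG}_m(n)$, $f^{TkC}_m(n)$, $f^{MS}_m(n)$ be the numbers of 2-factors of the rectangular grid graph $RG_m(n)$, the thick grid cylinder $TkC_m(n)$ and the Moebius strip $MS_m(n)$, respectively. Let $\mathcal T^*_m=[a_{i,j}]$ be the adjacency matrix of the digraph $\mathcal D^*_m$, with vertices $v_1,v_2,\dots$ enumerated so that $v_1=00\cdots0$ ($m$ zeros), and let $a^{(n)}_{i,j}$ denote the $(i,j)$-entry of $(\mathcal T^*_m)^n$. Then $$f^{RG}_m(n)=a^{(n)}_{1,1},\qquad f^{TkC}_m(n)=\operatorname{tr}\big((\mathcal T^*_m)^n\big)=\sum_{v_i\in V(\mathcal D^*_m)}a^{(n)}_{i,i},\qquad f^{MS}_m(n)=\operatorname{tr}\big(\mathcal P^*_m\cdot(\mathcal T^*_m)^n\big).$$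
   Context: Graphs: all three have vertex set $\{1,\dots,m\}\times\{1,\dots,n\}$ (row $i$, column $j$) and contain one vertical edge joining $(i,j)$ and $(i+1,j)$ for $1\le i\le m-1$, $1\le j\le n$, and one horizontal edge joining $(i,j)$ and $(i,j+1)$ for $1\le i\le m$, $1\le j\le n-1$. $RG_m(n)=P_m\times P_n$ has no further edges. $TkC_m(n)=P_m\times C_n$ has in addition, for each $i$, one edge joining $(i,n)$ and $(i,1)$. $MS_m(n)$ has in addition, for each $i$, one edge joining $(i,n)$ and $(m-i+1,1)$. For small $n$ these are multigraphs (the additional edges are distinct from all others, so parallel edges and loops may occur; a loop contributes 2 to the degree). A 2-factor is a spanning 2-regular subgraph (set of edges giving every vertex degree 2). Digraph $\mathcal D_m$: let $\mathcal D_{ud}$ be the digraph on $\{a,b,c,d,e,f\}$ with arcs from each of $a,b,d$ to each of $b,c,f$, and from each of $c,e,f$ to each of $a,d,e$; let $\mathcal D_{lr}$ be the digraph on the same letters with arcs from each of $a,c,e$ to each of $d,e,f$, and from each of $b,d,f$ to each of $a,b,c$. $V(\mathcal D_m)$ is the set of words $\alpha_1\cdots\alpha_m$ over $\{a,b,c,d,e,f\}$ with $\alpha_1\in\{a,d,e\}$, $\alpha_m\in\{c,e,f\}$ and each $(\alpha_i,\alpha_{i+1})$, $1\le i\le m-1$, an arc of $\mathcal D_{ud}$. There is an arc $\alpha_1\cdots\alpha_m\to\beta_1\cdots\beta_m$ in $\mathcal D_m$ iff every $(\alpha_i,\beta_i)$ is an arc of $\mathcal D_{lr}$. Digraph $\mathcal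 D^*_m$: the outlet word of $\alpha=\alpha_1\cdots\alpha_m\in V(\mathcal D_m)$ is the binary word $o(\alpha)=o_1\cdots o_m$ with $o_j=0$ if $\alpha_j\in\{b,d,f\}$ and $o_j=1$ if $\alpha_j\in\{a,c,e\}$. Then $V(\mathcal D^*_m)=\{o(\alpha):\alpha\in V(\mathcal D_m)\}$, and there is a (single) arc $v\to w$ in $\mathcal D^*_m$ iff there are $x,y\in V(\mathcal D_m)$ with $x\to y$ in $\mathcal D_m$, $o(x)=v$, $o(y)=w$ (loops allowed). For a binary word $v=b_1b_2\cdots b_m$ put $\overline v=b_m\cdots b_2b_1$. $\mathcal P^*_m=[p_{i,j}]$ is the square 0/1 matrix of order $|V(\mathcal D^*_m)|$ with $p_{i,j}=1$ iff $v_i=\overline{v_j}$. *)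

(* Defs.v *)
From HB Require Import structures.
From mathcomp Require Import all_boot all_order all_algebra.

Set Implicit Arguments.
Unset Strict Implicit.
Unset Printing Implicit Defensive.

(* Rows and columns are numbered from 0: the vertex (i, j) of the paper is
   (i - 1, j - 1) here, and the row m - i + 1 is [rev_ord]. *)

Record multigraph := Multigraph {
  vertex : finType;
  edge : finType;
  ends : edge -> vertex * vertex
}.

(* A loop at x has both its ends equal to x, hence counts twice. *)
Definition degree (G : multigraph) (F : {set edge G}) (x : vertex G) : nat :=
  \sum_(e in F) (((ends e).1 == x) + ((ends e).2 == x)).

Definition is_2factor (G : multigraph) (F : {set edge G}) : bool :=
  [forall x, degree F x == 2].

Definition nb_2factors (G : multigraph) : nat :=
  #|[set F : {set edge G} | is_2factor F]|.

Definition ord_lo n (i : 'I_n.-1) : 'I_n := widen_ord (leq_pred n) i.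

Lemma ord_hi_proof n (i : 'I_n.-1) : i.+1 < n.
Proof. by case: n i => [|n] []. Qed.

Definition ord_hi n (i : 'I_n.-1) : 'I_n := Ordinal (ord_hi_proof i).

Definition ord_first n (n_gt0 : 0 < n) : 'I_n := Ordinal n_gt0.

Lemma ord_last_proof n : 0 < n -> n.-1 < n.
Proof. by case: n. Qed.

Definition ord_last n (n_gt0 : 0 < n) : 'I_n := Ordinal (ord_last_proof n_gt0).

Definition grid_edge m n : finType := ('I_m.-1 * 'I_n + 'I_m * 'I_n.-1)%type.

Definition grid_ends m n (e : grid_edge m n) : ('I_m * 'I_n) * ('I_m * 'I_n) :=
  match e with
  | inl (i, j) => ((ord_lo i, j), (ord_hi i, j))
  | inr (i, j) => ((i, ord_lo j), (i, ord_hi j))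
  end.

Definition RG m n : multigraph := Multigraph (@grid_ends m n).

Definition TkC_ends m n (n_gt0 : 0 < n) (e : grid_edge m n + 'I_m) :
    ('I_m * 'I_n) * ('I_m * 'I_n) :=
  match e with
  | inl e' => grid_ends e'
  | inr i => ((i, ord_last n_gt0), (i, ord_first n_gt0))
  end.

Definition TkC m n (n_gt0 : 0 < n) : multigraph :=
  Multigraph (@TkC_ends m n n_gt0).

Definition MS_ends m n (n_gt0 : 0 < n) (e : grid_edge m n + 'I_m) :
    ('I_m * 'I_n) * ('I_m * 'I_n) :=
  match e with
  | inl e' => grid_ends e'
  | inr i => ((i, ord_last n_gt0), (rev_ord i, ord_first n_gt0))
  end.

Definition MS m n (n_gt0 : 0 < n) : multigraph :=
  Multigraph (@MS_ends m n n_gt0).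

Inductive letter := La | Lb | Lc | Ld | Le | Lf.

Definition letter_code (x : letter) : nat :=
  match x with La => 0 | Lb => 1 | Lc => 2 | Ld => 3 | Le => 4 | Lf => 5 end.

Definition letter_decode (i : nat) : letter :=
  nth La [:: La; Lb; Lc; Ld; Le; Lf] i.

Lemma letter_codeK : cancel letter_code letter_decode.
Proof. by case. Qed.

HB.instance Definition _ := Countable.copy letter (can_type letter_codeK).

Lemma letter_enumP : Finite.axiom [:: La; Lb; Lc; Ld; Le; Lf].
Proof. by case. Qed.

HB.instance Definition _ := isFinite.Build letter letter_enumP.

Definition Dud_arc (x y : letter) : bool :=
  (x \in [:: La; Lb; Ld]) && (y \in [:: Lb; Lc; Lf])
  || (x \in [:: Lc; Le; Lf]) && (y \in [:: La; Ld; Le]).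

Definition Dlr_arc (x y : letter) : bool :=
  (x \in [:: La; Lc; Le]) && (y \in [:: Ld; Le; Lf])
  || (x \in [:: Lb; Ld; Lf]) && (y \in [:: La; Lb; Lc]).

Definition D_vertex m : {set m.-tuple letter} :=
  [set w : m.-tuple letter |
    if tval w is x :: s then
      [&& x \in [:: La; Ld; Le], last x s \in [:: Lc; Le; Lf]
        & path Dud_arc x s]
    else false].

Definition D_arc m (w z : m.-tuple letter) : bool :=
  [forall i, Dlr_arc (tnth w i) (tnth z i)].

Definition outlet m (w : m.-tuple letter) : m.-tuple bool :=
  [tuple of [seq x \in [:: La; Lc; Le] | x <- w]].

Definition Dstar_vertex m : {set m.-tuple bool} :=
  [set outlet w | w in D_vertex m].

Definition Dstar_arc m (v w : m.-tuple bool) : bool :=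
  [exists x in D_vertex m, exists y in D_vertex m,
    [&& D_arc x y, outlet x == v & outlet y == w]].

(* Here v lists the vertices of the digraph D*_m. *)
Definition Tstar m k (v : 'I_k -> m.-tuple bool) : 'M[nat]_k :=
  \matrix_(i, j) nat_of_bool (Dstar_arc (v i) (v j)).

Definition Pstar m k (v : 'I_k -> m.-tuple bool) : 'M[nat]_k :=
  \matrix_(i, j) nat_of_bool (v i == [tuple of rev (v j)]).

Definition zero_word m : m.-tuple bool := [tuple of nseq m false].

(* The word d b ... b f has outlet word 00...0, so for m >= 2 there are
   enumerations of V(D*_m) that start with 00...0. *)
Lemma zero_word_Dstar m : 1 < m -> zero_word m \in Dstar_vertex m.
Proof.
case: m => [|[|m]] // _.
have szw : size (Ld :: rcons (nseq m Lb) Lf) == m.+2.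
  by rewrite /= size_rcons size_nseq.
apply/imsetP; exists (Tuple szw).
  rewrite inE /= last_rcons rcons_path.
  have path_b x : Dud_arc x Lb -> Dud_arc x Lf ->
      path Dud_arc x (nseq m Lb) && Dud_arc (last x (nseq m Lb)) Lf.
    by elim: m {szw} x => [|m IHm] x //= xb xf; rewrite xb IHm.
  exact: path_b.
apply: val_inj; rewrite /= map_rcons map_nseq; congr (_ :: _).
by elim: m {szw} => //= m ->.
Qed.

Lemma Dstar_enumeration m : 1 < m ->
  exists k (v : 'I_k.+1 -> m.-tuple bool),
    [/\ injective v, codom v =i Dstar_vertex m & v ord0 = zero_word m].
Proof.
move=> /zero_word_Dstar z_in.
pose s := zero_word m :: enum (Dstar_vertex m :\ zero_word m).
have s_uniq : uniq s by rewrite /= enum_uniq mem_enum !inE eqxx.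
exists (size s).-1, (fun i => nth (zero_word m) s i); split=> //.
- by move=> i j /eqP; rewrite nth_uniq // => /eqP/val_inj.
- move=> w; transitivity (w \in s).
    apply/codomP/idP => [[i ->]|/(nthP (zero_word m))[i lt_i <-]].
      exact: mem_nth.
    by exists (Ordinal lt_i).
  by rewrite inE mem_enum !inE; case: eqP => [->|].
Qed.

(* Main.v *)
Require Import Defs.
From mathcomp Require Import all_boot all_order all_algebra.
From mathcomp Require Import zify.
Import GRing.Theory.

Set Implicit Arguments.
Unset Strict Implicit.
Unset Printing Implicit Defensive.

(** Cut the graph along the horizontal edges. A 2-factor F gives to each column
    j the binary word of the edges of F that leave it to the right; the word of
    the edges that enter it from the left is the right word of column j - 1 or,
    for the first column, what the additional edges make of the right word of
    the last one.

    A set F is a 2-factor exactly when each column is saturated: its left word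
    l, its right word r and its vertical edges together give degree 2 at each of
    its vertices. Reading a vertex of degree 2 as the letter that names its two
    half-edges turns a saturated column into a vertex of D_m with outlet word r,
    and every vertex of D_m arises so. Hence l -> r is an arc of D*_m iff l is a
    vertex of D*_m and some saturated column has left word l and right word r
    ([Dstar_arcP]). Such a column is determined by l and r, because the degree
    conditions give its vertical edges one by one from the top
    ([column_ok_uniq]). Therefore F is determined by its right words, and the
    words that occur are the walks of length n in D*_m from the left word of the
    first column to the right word of the last one
    ([card_2factors_closing]), which the powers of the adjacency matrix count
    ([Tstar_exp]).

    The three graphs differ only in how the last column is glued to the first.
    Gluing row i to row s i, for an involution s, makes the walk go from w with
    its letters permuted by s to w, where w is the right word of the last
    column. The cylinder is s = id and the strip is s = [rev_ord], which maps
    vertices of D*_m to vertices because a saturated column can be turned upside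
    down. The 2-factors of the rectangular grid are those of the cylinder with
    w = 00...0. *)

(** * Counting the edges with a given end *)

(** Multigraph degrees sum over all edges; an injective family of half-edges
    meets a given vertex at most once, so that its share of the degree is a
    single bit. *)
Lemma sum_inj_hit (I V : finType) (f : I -> V) (p : pred I) x :
  injective f ->
  \sum_(i | p i) (f i == x) = [exists i, p i && (f i == x)] :> nat.
Proof.
move=> f_inj; case: existsP => [[i /andP[pi /eqP fi]]|no_hit].
  rewrite (bigD1 i) //= fi eqxx big1 // => j /andP[_ /eqP ne_ji].
  by case: eqP => // fj; case: ne_ji; apply: f_inj; rewrite fi.
by rewrite big1 // => i pi; case: eqP => // fi; case: no_hit; exists i; rewrite pi fi eqxx.
Qed.

Lemma exists_hit (I V : finType) (f : I -> V) (p : pred I) i :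
  injective f -> [exists j, p j && (f j == f i)] = p i.
Proof.
move=> f_inj; apply/existsP/idP => [[j /andP[pj /eqP/f_inj <-]] //|pi].
by exists i; rewrite pi eqxx.
Qed.

Lemma ord_lo_inj m : injective (@ord_lo m).
Proof. by move=> i j /(congr1 val) /= /val_inj. Qed.

Lemma ord_hi_inj m : injective (@ord_hi m).
Proof. by move=> i j /(congr1 val) /= [] /val_inj. Qed.

(** * Saturated columns *)

Section Column.

Variable m : nat.

Implicit Types (u : pred 'I_m.-1) (l r : m.-tuple bool).

(** [u i'] tells whether the vertical edge between rows i' and i' + 1 is chosen;
    the first row has no edge above it and the last one none below. *)
Definition down_bit u (i : 'I_m) := [exists i' : 'I_m.-1, u i' && (ord_lo i' == i)].

Definition up_bit u (i : 'I_m) := [exists i' : 'I_m.-1, u i' && (ord_hi i' == i)].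

Lemma eq_down_bit u u' : u =1 u' -> down_bit u =1 down_bit u'.
Proof. by move=> eq_u i; apply: eq_existsb => i'; rewrite eq_u. Qed.

Lemma eq_up_bit u u' : u =1 u' -> up_bit u =1 up_bit u'.
Proof. by move=> eq_u i; apply: eq_existsb => i'; rewrite eq_u. Qed.

Lemma down_bit_lo u i' : down_bit u (ord_lo i') = u i'.
Proof. exact: exists_hit (@ord_lo_inj m). Qed.

Lemma up_bit_hi u i' : up_bit u (ord_hi i') = u i'.
Proof. exact: exists_hit (@ord_hi_inj m). Qed.

Lemma down_bit_last u (i : 'I_m) : i = m.-1 :> nat -> down_bit u i = false.
Proof.
move=> def_i; apply/existsP => [[i' /andP[_ /eqP/(congr1 val) /= e]]].
by have := ltn_ord i'; rewrite e def_i ltnn.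
Qed.

Lemma up_bit_first u (i : 'I_m) : i = 0 :> nat -> up_bit u i = false.
Proof.
by move=> def_i; apply/existsP => [[i' /andP[_ /eqP/(congr1 val) /=]]]; rewrite def_i.
Qed.

Variant row_lo_spec (i : 'I_m) : Prop :=
  | RowLast of i = m.-1 :> nat
  | RowLo i' of i = ord_lo i'.

Lemma row_loP i : row_lo_spec i.
Proof.
have [lt_i|ge_i] := ltnP i m.-1.
  by apply: (@RowLo _ (Ordinal lt_i)); apply: val_inj.
by apply: RowLast; have := ltn_ord i; lia.
Qed.

Variant row_hi_spec (i : 'I_m) : Prop :=
  | RowFirst of i = 0 :> nat
  | RowHi i' of i = ord_hi i'.

Lemma row_hiP i : row_hi_spec i.
Proof.
case def_i: (nat_of_ord i) => [|i0]; first exact: RowFirst.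
have lt_i0 : i0 < m.-1 by have := ltn_ord i; lia.
by apply: (@RowHi _ (Ordinal lt_i0)); apply: val_inj.
Qed.

Definition column_ok l u r :=
  [forall i, up_bit u i + down_bit u i + tnth l i + tnth r i == 2].

Lemma column_okP l u r :
  reflect (forall i, up_bit u i + down_bit u i + tnth l i + tnth r i = 2)
          (column_ok l u r).
Proof. exact: 'forall_eqP. Qed.

(** Going down the column, the degree condition at row i determines the edge
    below row i from the edge above it. This is why D*_m, in which arcs are
    single, loses no information. *)
Lemma column_ok_uniq l u u' r :
  column_ok l u r -> column_ok l u' r -> u =1 u'.
Proof.
move=> /column_okP ok /column_okP ok' [k lt_k].
elim: k lt_k => [|k IHk] lt_k; set i := Ordinal lt_k;
    have := ok (ord_lo i); have := ok' (ord_lo i); rewrite !down_bit_lo.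
  by rewrite !up_bit_first //; case: (u i); case: (u' i) => //; lia.
have lt_k' : k < m.-1 by apply: ltnW.
have -> : ord_lo i = ord_hi (Ordinal lt_k') by apply: val_inj.
by rewrite !up_bit_hi (IHk lt_k'); case: (u i); case: (u' i) => //; lia.
Qed.

Lemma lo_rev (i : 'I_m.-1) : rev_ord (ord_lo i) = ord_hi (rev_ord i).
Proof. by apply: val_inj => /=; have := ltn_ord i; lia. Qed.

Lemma hi_rev (i : 'I_m.-1) : rev_ord (ord_hi i) = ord_lo (rev_ord i).
Proof. by apply: val_inj => /=; have := ltn_ord i; lia. Qed.

Definition twist (s : 'I_m -> 'I_m) (w : m.-tuple bool) : m.-tuple bool :=
  [tuple tnth w (s i) | i < m].

Lemma down_bit_rev u i : down_bit (u \o @rev_ord _) i = up_bit u (rev_ord i).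
Proof.
have [def_i|i' ->] := row_loP i; last by rewrite down_bit_lo lo_rev up_bit_hi.
by rewrite down_bit_last // up_bit_first //=; have := ltn_ord i; lia.
Qed.

Lemma up_bit_rev u i : up_bit (u \o @rev_ord _) i = down_bit u (rev_ord i).
Proof.
have [def_i|i' ->] := row_hiP i; last by rewrite up_bit_hi hi_rev down_bit_lo.
by rewrite up_bit_first // down_bit_last //=; have := ltn_ord i; lia.
Qed.

Lemma column_ok_rev l u r :
  column_ok l u r ->
  column_ok (twist (@rev_ord _) l) (u \o @rev_ord _) (twist (@rev_ord _) r).
Proof.
move=> /column_okP ok; apply/column_okP => i.
by rewrite up_bit_rev down_bit_rev !tnth_mktuple (addnC (down_bit _ _ : nat)) ok.
Qed.

End Column.

(** * Letters as vertices of degree 2 *)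

(** The letters are the six pairs of half-edges at a vertex: down-right,
    up-down, up-right, down-left, left-right and up-left, in this order. *)
Definition up (x : letter) := x \in [:: Lb; Lc; Lf].
Definition down (x : letter) := x \in [:: La; Lb; Ld].
Definition left (x : letter) := x \in [:: Ld; Le; Lf].
Definition right (x : letter) := x \in [:: La; Lc; Le].

Lemma letter_degree x : up x + down x + left x + right x = 2.
Proof. by case: x. Qed.

(** The fourth bit follows from the other three, as two of the four are set. *)
Definition mk_letter (pu pd pl : bool) : letter :=
  match pu, pd, pl with
  | true, true, _ => Lb
  | true, false, true => Lf
  | true, false, false => Lc
  | false, true, true => Ld
  | false, true, false => La
  | false, false, _ => Le
  end.

Lemma mk_letterP (pu pd pl pr : bool) : pu + pd + pl + pr = 2 ->
  let x := mk_letter pu pd pl in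
  [/\ up x = pu, down x = pd, left x = pl & right x = pr].
Proof. by case: pu; case: pd; case: pl; case: pr. Qed.

Lemma Dud_arcE x y : Dud_arc x y = (down x == up y).
Proof. by case: x; case: y. Qed.

Lemma Dlr_arcE x y : Dlr_arc x y = (right x == left y).
Proof. by case: x; case: y. Qed.

Section Letters.

Variable m : nat.
Hypothesis m_gt0 : 0 < m.

Implicit Types (u : pred 'I_m.-1) (l r : m.-tuple bool) (y : m.-tuple letter).

Definition inlet y : m.-tuple bool := [tuple of map left y].

Lemma D_arcE (x y : m.-tuple letter) : D_arc x y = (outlet x == inlet y).
Proof.
apply/forallP/eqP => [arcs|eq_xy i].
  apply: eq_from_tnth => i; rewrite !tnth_map.
  by apply/eqP; have := arcs i; rewrite Dlr_arcE.
by rewrite Dlr_arcE; have := congr1 (fun t => tnth t i) eq_xy; rewrite !tnth_map => /eqP.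
Qed.

(** An arc of D_ud says that the lower half of a vertical edge is used iff its
    upper half is, so a vertex of D_m is a consistent choice of vertical edges. *)
Lemma D_vertexP y :
  reflect (exists u, forall i, up (tnth y i) = up_bit u i
                            /\ down (tnth y i) = down_bit u i)
          (y \in D_vertex m).
Proof.
have y_nth (i : 'I_m) : tnth y i = nth La y i by rewrite (tnth_nth La).
have sz_y := size_tuple y; rewrite inE.
case def_y: (tval y) sz_y => [|x s] sz_y; first by exfalso; move: m_gt0; rewrite -sz_y.
have -> : (x \in [:: La; Ld; Le]) = ~~ up x by case: (x).
have -> : (last x s \in [:: Lc; Le; Lf]) = ~~ down (last x s) by case: (last x s).
have sz_s : size s = m.-1 by rewrite -sz_y.
have nth_end : nth La (x :: s) m.-1 = last x s.
  by rewrite -sz_s -[last x s](nth_last La (x :: s)).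
apply: (iffP and3P) => [[up_x down_l /(pathP La) arcs]|[u uP]].
  exists (fun i' => down (tnth y (ord_lo i'))) => i; split.
    have [def_i|i' ->] := row_hiP i.
      by rewrite up_bit_first // y_nth def_i def_y; apply/negbTE.
    rewrite up_bit_hi !y_nth def_y /=; have := arcs i'.
    by rewrite sz_s Dud_arcE => /(_ (ltn_ord i'))/eqP.
  have [def_i|i' ->] := row_loP i; last by rewrite down_bit_lo.
  by rewrite down_bit_last // y_nth def_i def_y nth_end; apply/negbTE.
have i_first : 0 < m by [].
have i_last : m.-1 < m by rewrite prednK.
split.
- have [] := uP (Ordinal i_first).
  by rewrite y_nth def_y /= => -> _; rewrite up_bit_first.
- have [_] := uP (Ordinal i_last).
  by rewrite y_nth def_y nth_end => ->; rewrite down_bit_last.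
apply/(pathP La) => k; rewrite sz_s => lt_k; rewrite Dud_arcE.
have [_] := uP (ord_lo (Ordinal lt_k)); have [+ _] := uP (ord_hi (Ordinal lt_k)).
by rewrite down_bit_lo up_bit_hi !y_nth def_y /= => -> ->.
Qed.

Lemma column_okW y : y \in D_vertex m -> exists u, column_ok (inlet y) u (outlet y).
Proof.
case/D_vertexP => u uP; exists u; apply/column_okP => i.
by rewrite !tnth_map; have [<- <-] := uP i; apply: letter_degree.
Qed.

Lemma column_word l u r : column_ok l u r ->
  exists2 y, y \in D_vertex m & inlet y = l /\ outlet y = r.
Proof.
move=> /column_okP ok.
exists [tuple mk_letter (up_bit u i) (down_bit u i) (tnth l i) | i < m].
  by apply/D_vertexP; exists u => i; rewrite tnth_mktuple; have [] := mk_letterP (ok i).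
by split; apply: eq_from_tnth => i; rewrite tnth_map tnth_mktuple;
  have [] := mk_letterP (ok i).
Qed.

Lemma Dstar_vertexP r :
  reflect (exists l u, column_ok l u r) (r \in Dstar_vertex m).
Proof.
apply: (iffP imsetP) => [[y /column_okW[u ok] ->]|[l [u /column_word[y yD [_ <-]]]]].
  by exists (inlet y), u.
by exists y.
Qed.

(** The column that carries the arc shows that its right word is an outlet word,
    so membership has to be asked of the origin of the arc only. *)
Lemma Dstar_arcP l r :
  reflect (l \in Dstar_vertex m /\ exists u, column_ok l u r) (Dstar_arc l r).
Proof.
apply: (iffP existsP) => [[x /andP[xD /existsP[y /and4P[yD]]]]|[]].
  rewrite D_arcE => /eqP io /eqP <- /eqP <-; rewrite {2}io; split; last exact: column_okW.
  exact: imset_f.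
case/imsetP=> x xD -> [u /column_word[y yD [yl yr]]].
by exists x; rewrite xD; apply/existsP; exists y; rewrite yD D_arcE yl yr !eqxx.
Qed.

Lemma Dstar_arc_target l r : Dstar_arc l r -> r \in Dstar_vertex m.
Proof. by case/Dstar_arcP=> _ ok; apply/Dstar_vertexP; exists l. Qed.

Lemma Dstar_vertex_rev r :
  r \in Dstar_vertex m -> twist (@rev_ord _) r \in Dstar_vertex m.
Proof.
case/Dstar_vertexP => l [u /column_ok_rev ok]; apply/Dstar_vertexP.
by exists (twist (@rev_ord _) l), (u \o @rev_ord _).
Qed.

End Letters.

(** * Walks and powers of the adjacency matrix *)

Section Walks.

Variable m : nat.
Implicit Types a b : m.-tuple bool.

Definition walks n a b : {set n.-tuple (m.-tuple bool)} :=
  [set h : n.-tuple _ | path (@Dstar_arc m) a h & last a h == b].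

Lemma card_walks0 a b : #|walks 0 a b| = (a == b).
Proof.
rewrite /walks; case: eqP => ab.
  apply/eqP/cards1P; exists [tuple]; apply/setP => h.
  by rewrite !inE tuple0 /= ab eqxx.
by apply: eq_card0 => h; rewrite !inE tuple0 /=; apply/eqP.
Qed.

Lemma card_walksS n a b :
  #|walks n.+1 a b| = \sum_(z | Dstar_arc a z) #|walks n z b|.
Proof.
rewrite -sum1_card (partition_big (@thead _ _) (Dstar_arc a)) /=; last first.
  by move=> h; rewrite inE [h]tuple_eta /= theadE => /andP[/andP[]].
apply: eq_bigr => z az; rewrite -sum1_card.
rewrite (reindex_onto (fun t : n.-tuple _ => [tuple of z :: t]) (@behead_tuple n.+1 _)) /=.
  apply: eq_bigl => t; rewrite !inE /= az theadE eqxx /= andbT.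
  by rewrite (_ : @behead_tuple n.+1 _ _ = t) ?eqxx ?andbT //; apply: val_inj.
by move=> h /andP[_ /eqP <-]; rewrite -tuple_eta.
Qed.

End Walks.

Lemma sum_codom (I J : finType) (f : I -> J) (P : pred J) (F : J -> nat) :
    injective f -> (forall z, P z -> z \in codom f) ->
  \sum_(z | P z) F z = \sum_(i | P (f i)) F (f i).
Proof.
move=> f_inj Pf; rewrite (reindex_omap f (fun z => [pick i | f i == z])) /=.
  apply: eq_bigl => i; case: pickP => [j /eqP/f_inj-> | /(_ i) /=]; last by rewrite eqxx.
  by rewrite eqxx andbT.
move=> z /Pf/codomP[i ->]; case: pickP => [j /eqP <- // | /(_ i) /=];
  by rewrite eqxx.
Qed.

(** Walks may pass through arbitrary binary words while the matrix only knows the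
    vertices of D*_m; both count the same, as arcs end in vertices of D*_m. *)
Lemma Tstar_exp m k (v : 'I_k.+1 -> m.-tuple bool) :
    0 < m -> injective v -> codom v =i Dstar_vertex m ->
  forall n i j, (Tstar v ^+ n)%R i j = #|walks n (v i) (v j)|.
Proof.
move=> m_gt0 v_inj v_onto; elim=> [|n IHn] i j.
  by rewrite expr0 mxE card_walks0 (inj_eq v_inj); case: eqP.
rewrite exprS -mulmxE mxE card_walksS (@sum_codom _ _ v) //; last first.
  by move=> z /(Dstar_arc_target m_gt0); rewrite v_onto.
rewrite [RHS]big_mkcond; apply: eq_bigr => l _; rewrite mxE IHn.
by case: ifP => _; [apply: mul1n | apply: mul0n].
Qed.

(** * Grids whose last column is glued to the first by an involution of the rows *)

(** With s = id and s = [rev_ord] these are, by conversion, the ends of [TkC] and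
    [MS]. *)
Definition twisted_ends m n (n_gt0 : 0 < n) (s : 'I_m -> 'I_m)
    (e : grid_edge m n + 'I_m) : ('I_m * 'I_n) * ('I_m * 'I_n) :=
  match e with
  | inl e' => grid_ends e'
  | inr i => ((i, ord_last n_gt0), (s i, ord_first n_gt0))
  end.

Definition twisted_grid m n (n_gt0 : 0 < n) (s : 'I_m -> 'I_m) : multigraph :=
  Multigraph (@twisted_ends m n n_gt0 s).

Section TwistedGrid.

Variables (m n : nat) (m_gt0 : 0 < m) (n_gt0 : 0 < n) (s : 'I_m -> 'I_m).
Hypothesis sK : involutive s.

Local Notation G := (twisted_grid n_gt0 s).
Implicit Types (F : {set edge G}) (i : 'I_m).

(** The edge that leaves (i, j) to the right is a closing edge when j is the last
    column. *)
Definition right_edge i (j : nat) : edge G :=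
  if insub j is Some j' then inl (inr (i, j')) else inr i.

(** As s is an involution, the closing edge that enters row i of the first column
    starts in row s i. *)
Definition left_edge i (j : nat) : edge G :=
  if j is j'.+1 then right_edge i j' else inr (s i).

Definition vertical F (j : 'I_n) : pred 'I_m.-1 :=
  fun i' : 'I_m.-1 => inl (inl (i', j)) \in F.

(** Each vertex is the left end of exactly one of these edges, and the right end
    of exactly one. *)
Definition h_edge (e : 'I_m * 'I_n.-1 + 'I_m) : edge G :=
  match e with inl ij => inl (inr ij) | inr i => inr i end.

Lemma left_end_inj : injective (fun e => (ends (h_edge e)).1).
Proof.
case=> [[i j]|i] [[i' j']|i'] //= [-> // e].
- by congr (inl (_, _)); apply: val_inj.
- by have := ltn_ord j; rewrite e ltnn.
by have := ltn_ord j'; rewrite -e ltnn.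
Qed.

Lemma right_end_inj : injective (fun e => (ends (h_edge e)).2).
Proof.
case=> [[i j]|i] [[i' j']|i'] //= [].
  by move=> -> e; congr (inl (_, _)); apply: val_inj.
by move/(can_inj sK)->.
Qed.

Lemma right_edgeP i (j : 'I_n) :
  exists2 e, h_edge e = right_edge i j & (ends (h_edge e)).1 = (i, j).
Proof.
rewrite /right_edge; case: insubP => [j' _ def_j'|ge_j].
  by exists (inl (i, j')) => //=; congr (_, _); apply: val_inj.
exists (inr i) => //=; congr (_, _); apply: val_inj => /=.
by have := ltn_ord j; lia.
Qed.

Lemma left_edgeP i (j : 'I_n) :
  exists2 e, h_edge e = left_edge i j & (ends (h_edge e)).2 = (i, j).
Proof.
case: j => [[|j] lt_j] /=.
  by exists (inr (s i)) => //=; rewrite sK; congr (_, _); apply: val_inj.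
have lt_j' : j < n.-1 by lia.
rewrite /right_edge insubT.
by exists (inl (i, Ordinal lt_j')) => //=; congr (_, _); apply: val_inj.
Qed.

(** A closing edge may be a loop or join the ends of another edge when n is small;
    counting half-edges, which stay distinct, makes the formula uniform. *)
Lemma degreeE F i (j : 'I_n) :
  degree F (i, j) = up_bit (vertical F j) i + down_bit (vertical F j) i
                    + (left_edge i j \in F) + (right_edge i j \in F).
Proof.
have [er <- er1] := right_edgeP i j; have [el <- el2] := left_edgeP i j.
pose v_edge (p : 'I_m.-1 * 'I_n) : edge G := inl (inl p).
rewrite /degree.
(* Separate the vertical edges from all the others. *)
have split_edges (f : edge G -> nat) : \sum_(e in F) f e =
    \sum_(p | v_edge p \in F) f (v_edge p) + \sum_(e | h_edge e \in F) f (h_edge e).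
  rewrite !big_sumType /= addnA; congr (_ + _ + _).
have v_lo : injective (fun p => (ends (v_edge p)).1).
  by case=> [i1 j1] [i2 j2] [/val_inj-> ->].
have v_hi : injective (fun p => (ends (v_edge p)).2).
  by case=> [i1 j1] [i2 j2] [/val_inj-> ->].
rewrite split_edges !big_split /= (sum_inj_hit _ _ v_lo) (sum_inj_hit _ _ v_hi).
rewrite (sum_inj_hit _ _ left_end_inj) (sum_inj_hit _ _ right_end_inj).
pose in_F e := h_edge e \in F.
have := exists_hit in_F er left_end_inj; rewrite er1 => ->.
have := exists_hit in_F el right_end_inj; rewrite el2 => ->.
have -> : [exists p, (v_edge p \in F) && ((ends (v_edge p)).1 == (i, j))]
          = down_bit (vertical F j) i.
  apply/existsP/existsP => [[[i' j'] /andP[Fij /eqP[lo_i def_j]]]|[i' /andP[Fij /eqP <-]]].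
    by exists i'; rewrite /vertical -def_j Fij lo_i eqxx.
  by exists (i', j); apply/andP.
have -> : [exists p, (v_edge p \in F) && ((ends (v_edge p)).2 == (i, j))]
          = up_bit (vertical F j) i.
  apply/existsP/existsP => [[[i' j'] /andP[Fij /eqP[hi_i def_j]]]|[i' /andP[Fij /eqP <-]]].
    by exists i'; rewrite /vertical -def_j Fij hi_i eqxx.
  by exists (i', j); apply/andP.
by rewrite [in_F er + _]addnC addnA [down_bit _ _ + _]addnC.
Qed.

Definition right_word F j : m.-tuple bool := [tuple right_edge i j \in F | i < m].

Definition left_word F j : m.-tuple bool := [tuple left_edge i j \in F | i < m].

Definition closing_word F : m.-tuple bool :=
  [tuple (inr i : edge G) \in F | i < m].

Definition words F : n.-tuple (m.-tuple bool) := [tuple right_word F j | j < n].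

Lemma is_2factorP F :
  reflect (forall j : 'I_n, column_ok (left_word F j) (vertical F j) (right_word F j))
          (is_2factor F).
Proof.
apply: (iffP 'forall_eqP) => [deg2 j | ok [i j]].
  by apply/column_okP => i; have := deg2 (i, j); rewrite degreeE !tnth_mktuple.
by have /column_okP/(_ i) := ok j; rewrite degreeE !tnth_mktuple.
Qed.

Lemma right_edge_last i : right_edge i n.-1 = inr i.
Proof. by rewrite /right_edge insubF // ltnn. Qed.

Lemma right_edge_lt i (j : 'I_n.-1) : right_edge i j = inl (inr (i, j)).
Proof. by rewrite /right_edge valK. Qed.

Lemma nth_words F w j : j < n -> nth w (words F) j = right_word F j.
Proof. by move=> lt_j; rewrite -[j]/(val (Ordinal lt_j)) -tnth_nth tnth_mktuple. Qed.

Lemma last_tuple_nth a w (h : n.-tuple (m.-tuple bool)) : last a h = nth w h n.-1.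
Proof.
by case: h => [[|x h] sz_h] /=; move: sz_h n_gt0 => /eqP <- //; rewrite (nth_last w (x :: h)).
Qed.

Lemma last_words F a : last a (words F) = closing_word F.
Proof.
rewrite (last_tuple_nth _ a) nth_words ?prednK //.
by apply: eq_from_tnth => i; rewrite !tnth_mktuple right_edge_last.
Qed.

Lemma left_wordE F w j :
  j < n -> left_word F j = nth w (twist s (closing_word F) :: words F) j.
Proof.
case: j => [|j] lt_j /=; last by rewrite nth_words // ltnW.
by apply: eq_from_tnth => i; rewrite !tnth_mktuple.
Qed.

(** Every horizontal or closing edge can be read off the right words, and the
    vertical ones follow by uniqueness of the saturated columns. *)
Lemma words_inj : {in [set F : {set edge G} | is_2factor F] &, injective words}.
Proof.
move=> F F'; rewrite !inE => /is_2factorP ok /is_2factorP ok' eq_FF'.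
have eq_cl : closing_word F = closing_word F'.
  by rewrite -!(last_words _ (zero_word m)) eq_FF'.
have eq_r (j : 'I_n) : right_word F j = right_word F' j.
  by rewrite -!(nth_words _ (zero_word m)) ?eq_FF'.
have eq_l (j : 'I_n) : left_word F j = left_word F' j.
  by rewrite !(left_wordE _ (zero_word m)) ?eq_FF' ?eq_cl.
apply/setP => -[[[i j]|[i j]]|i].
- by have := ok' j; rewrite -eq_l -eq_r => /(column_ok_uniq (ok j))/(_ i).
- have := congr1 (fun t => tnth t i) (eq_r (ord_lo j)).
  by rewrite !tnth_mktuple right_edge_lt.
by have := congr1 (fun t => tnth t i) eq_cl; rewrite !tnth_mktuple.
Qed.

Hypothesis Dstar_twist : forall w : m.-tuple bool,
  w \in Dstar_vertex m -> twist s w \in Dstar_vertex m.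

(** The stability of the vertices of D*_m under s is used for the first arc, whose
    origin is a twisted outlet word. *)
Lemma words_walk F :
  is_2factor F -> words F \in walks n (twist s (closing_word F)) (closing_word F).
Proof.
move=> /is_2factorP ok; rewrite inE last_words eqxx andbT.
have right_Dstar j : j < n -> right_word F j \in Dstar_vertex m.
  move=> lt_j; apply/(Dstar_vertexP m_gt0).
  by exists (left_word F j), (vertical F (Ordinal lt_j)); apply: ok.
apply/(pathP (zero_word m)) => j; rewrite size_tuple => lt_j.
rewrite -left_wordE // nth_words //; apply/(Dstar_arcP m_gt0).
split; last by exists (vertical F (Ordinal lt_j)); apply: ok.
rewrite (left_wordE _ (zero_word m)) //; case: j lt_j => [|j] lt_j /=.
  apply: Dstar_twist; rewrite -(last_words _ (zero_word m)).
  by rewrite (last_tuple_nth _ (zero_word m)) nth_words ?right_Dstar // prednK.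
by rewrite nth_words ?right_Dstar // ltnW.
Qed.

(** Choose for each arc a saturated column that carries it; consecutive columns
    agree on the horizontal edges between them. *)
Lemma walk_words w h : h \in walks n (twist s w) w ->
  exists2 F, is_2factor F & words F = h.
Proof.
rewrite inE => /andP[/(pathP w) arcs /eqP last_h].
have /fin_all_exists[u ok] (j : 'I_n) :
    exists u, column_ok (nth w (twist s w :: h) j) u (nth w h j).
  by have := arcs j; rewrite size_tuple => /(_ (ltn_ord j))/(Dstar_arcP m_gt0)[].
pose F : {set edge G} := [set e : edge G | match e with
  | inl (inl (i', j)) => u j i'
  | inl (inr (i, j')) => tnth (nth w h j') i
  | inr i => tnth w i
  end].
have FE i j : j < n -> (right_edge i j \in F) = tnth (nth w h j) i.
  move=> lt_j; rewrite /right_edge.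
  case: insubP => [j' _ <-|ge_j]; rewrite inE //.
  have -> : j = n.-1 by lia.
  by rewrite -(last_tuple_nth (twist s w)) last_h.
have right_F j : j < n -> right_word F j = nth w h j.
  by move=> lt_j; apply: eq_from_tnth => i; rewrite tnth_mktuple FE.
have words_F : words F = h.
  by apply: eq_from_tnth => j; rewrite tnth_mktuple right_F // -tnth_nth.
have closing_F : closing_word F = w by rewrite -(last_words _ (twist s w)) words_F.
exists F => //; apply/is_2factorP => j.
rewrite (left_wordE _ w) // closing_F words_F right_F //.
have /column_okP okj := ok j; apply/column_okP => i; rewrite -(okj i).
have eq_u : vertical F j =1 u j by move=> i'; rewrite /vertical inE.
by rewrite (eq_up_bit eq_u) (eq_down_bit eq_u).
Qed.

Lemma card_2factors_closing w :
  #|[set F : {set edge G} | is_2factor F & closing_word F == w]|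
  = #|walks n (twist s w) w|.
Proof.
rewrite -(card_in_imset (f := words)); last first.
  by move=> F F'; rewrite !inE => /andP[ok _] /andP[ok' _]; apply: words_inj; rewrite inE.
apply: eq_card => h; apply/imsetP/idP => [[F]|h_walk].
  by rewrite inE => /andP[/words_walk walkF /eqP <-] ->.
have [F ok def_h] := walk_words h_walk; exists F => //.
by rewrite inE ok -(last_words _ (twist s w)) def_h; move: h_walk; rewrite inE => /andP[].
Qed.

(** As n > 0, a walk ends with an arc. *)
Lemma walks_Dstar a b : b \notin Dstar_vertex m -> #|walks n a b| = 0.
Proof.
move=> bD; apply: eq_card0 => h; rewrite inE; apply/negbTE; apply: contra bD.
case/andP=> /(pathP a) arcs /eqP <-; rewrite (last_tuple_nth _ a).
by apply: (Dstar_arc_target m_gt0 (arcs n.-1 _)); rewrite size_tuple prednK.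
Qed.

Lemma nb_2factors_twisted k (v : 'I_k -> m.-tuple bool) :
    injective v -> codom v =i Dstar_vertex m ->
  nb_2factors G = \sum_i #|walks n (twist s (v i)) (v i)|.
Proof.
move=> v_inj v_onto.
have fiber w : \sum_(F in [set F : {set edge G} | is_2factor F] | closing_word F == w) 1
               = #|walks n (twist s w) w|.
  by rewrite -card_2factors_closing -sum1_card; apply: eq_bigl => F; rewrite !inE.
rewrite /nb_2factors -sum1_card (partition_big closing_word predT) //=.
rewrite (eq_bigr _ (fun w _ => fiber w)) (bigID (mem (Dstar_vertex m))) /=.
rewrite [X in _ + X]big1 ?addn0 => [|w]; last exact: walks_Dstar.
rewrite (sum_codom _ v_inj) => [|w]; last by rewrite v_onto.
by apply: eq_bigl => i; rewrite -v_onto codom_f.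
Qed.

End TwistedGrid.

Lemma twist_id m (w : m.-tuple bool) : twist id w = w.
Proof. by apply: eq_from_tnth => i; rewrite tnth_mktuple. Qed.

Lemma twist_rev m (w : m.-tuple bool) : twist (@rev_ord m) w = [tuple of rev w].
Proof.
apply: eq_from_tnth => i.
by rewrite tnth_mktuple !(tnth_nth false) /= nth_rev size_tuple.
Qed.

(** * The three graphs *)

Lemma nb_2factors_RG m n (n_gt0 : 0 < n) :
  nb_2factors (RG m n) =
  #|[set F : {set edge (twisted_grid n_gt0 (@id 'I_m))} |
      is_2factor F & closing_word F == zero_word m]|.
Proof.
pose G := twisted_grid n_gt0 (@id 'I_m).
pose emb (e : edge (RG m n)) : edge G := inl e.
have emb_inj : injective emb by move=> e e' [].
have degE (F : {set edge (RG m n)}) x :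
    degree (G := G) [set emb e | e in F] x = degree F x.
  by rewrite /degree big_imset //; move=> ? ? _ _ /emb_inj.
rewrite /nb_2factors -(card_imset _ (imset_inj emb_inj)).
apply: eq_card => F; rewrite !inE; apply/imsetP/andP.
  case=> F'; rewrite inE => /forallP ok ->; split.
    by apply/forallP => x; rewrite degE.
  apply/eqP/eq_from_tnth => i; rewrite tnth_mktuple (tnth_nth false) nth_nseq ltn_ord.
  by apply/imsetP => -[].
case=> /forallP ok /eqP closed.
have defF : F = [set emb e | e in emb @^-1: F].
  apply/setP => -[e|i]; first by rewrite (mem_imset _ _ emb_inj) inE.
  have := congr1 (fun t => tnth t i) closed.
  rewrite tnth_mktuple (tnth_nth false) nth_nseq ltn_ord => ->.
  by apply/esym/imsetP => -[].
exists (emb @^-1: F) => //; rewrite inE; apply/forallP => x.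
by rewrite -degE -defF.
Qed.

Local Open Scope ring_scope.

Theorem theorem3p13 (m n : nat) (m_ge2 : (2 <= m)%N) (n_gt0 : (0 < n)%N)
  (k : nat) (v : 'I_k.+1 -> m.-tuple bool)
  (v_inj : injective v) (v_onto : codom v =i Dstar_vertex m)
  (v_first : v ord0 = zero_word m) :
  [/\ nb_2factors (RG m n) = (Tstar v ^+ n) ord0 ord0,
      nb_2factors (TkC m n_gt0) = \tr (Tstar v ^+ n)
        /\ \tr (Tstar v ^+ n) = \sum_(i < k.+1) (Tstar v ^+ n) i i
    & nb_2factors (MS m n_gt0) = \tr (Pstar v *m Tstar v ^+ n)].
Proof.
have m_gt0 : (0 < m)%N by apply: ltnW.
have T_walks := Tstar_exp m_gt0 v_inj v_onto n.
have id_inv : involutive (@id 'I_m) by [].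
have id_Dstar w : w \in Dstar_vertex m -> twist id w \in Dstar_vertex m.
  by rewrite twist_id.
split; [| split=> [|//] |].
- rewrite T_walks v_first (nb_2factors_RG m n_gt0).
  by rewrite (card_2factors_closing m_gt0 n_gt0 id_inv id_Dstar) twist_id.
- rewrite -[TkC m n_gt0]/(twisted_grid n_gt0 (@id 'I_m)).
  rewrite (nb_2factors_twisted m_gt0 n_gt0 id_inv id_Dstar v_inj v_onto).
  by apply: eq_bigr => i _; rewrite T_walks twist_id.
rewrite -[MS m n_gt0]/(twisted_grid n_gt0 (@rev_ord m)).
rewrite (nb_2factors_twisted m_gt0 n_gt0 (@rev_ordK m) (Dstar_vertex_rev m_gt0) v_inj v_onto).
apply: eq_bigr => i _; rewrite mxE.
have /codomP[j def_j] : twist (@rev_ord m) (v i) \in codom v.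
  by rewrite v_onto Dstar_vertex_rev // -v_onto codom_f.
(* Row i of Pstar selects the index j of the reversal of v i. *)
rewrite (bigD1 j) //= big1 => [|l ne_lj]; rewrite !mxE -twist_rev.
  rewrite -def_j (_ : _ == _) ?T_walks -?def_j; first by rewrite addr0 mul1r.
  by apply/eqP/eq_from_tnth => x; rewrite !tnth_mktuple rev_ordK.
rewrite (_ : _ == _ = false) ?mul0r //; apply: contraNF ne_lj => /eqP def_i.
apply/eqP/v_inj; rewrite -def_j def_i.
by apply: eq_from_tnth => x; rewrite !tnth_mktuple rev_ordK.
Qed.
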